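(* Let $j\in\mathbb{Z}$ and let $A\in\mathcal{Z}(j)$ be the equation $au^2+buv+cv^2+du+ev+f=0$. Put $\lambda=\frac b2$ and $\tau=\frac D4$. Then the following are all true: (a) $a=1$. (b) Equation $A$ can be rewritten as the equation $\tilde u^2-\tau\tilde v^2=j$, where $(\tilde u,\tilde v)=\left(u+\lambda v+\frac d2,\ v+\frac ED\right)$; that is, $(u,v)$ satisfies $A$ if and only if $(\tilde u,\tilde v)$ satisfies $\tilde u^2-\tau\tilde v^2=j$. (c) If $j=1$, then the set $\mathcal{D}_A$ of integer solutions $(u,v)\in\mathbb{Z}^2$ of $A$ is non-empty, has infinitely many elements, and is $$\mathcal{D}_A=\left\{(u,v)\in\mathbb{Z}^2:\ u=\tilde u-\lambda\tilde v+\tfrac ED\lambda-\tfrac d2,\ v=\tilde v-\tfrac ED,\ (\tilde u,\tilde v)\in\mathcal{P}_\tau\right\},$$ where $\mathcal{P}_\tau$ is the set of integer solutions $(\tilde u,\tilde v)\in\mathbb{Z}^2$ of $\tilde u^2-\tau\tilde v^2=1$.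
   Context: $\mathcal{A}$ denotes the set of all Diophantine equations $au^2+buv+cv^2+du+ev+f=0$ (unknowns $u,v$) with $a,b,c,d,e,f\in\mathbb{Z}$, $a>0$, $\gcd(a,b,c,d,e,f)=1$. For $A\in\mathcal{A}$ put $D=b^2-4ac$, $E=bd-2ae$, $F=d^2-4af$, $N=E^2-DF$. The equation $A\in\mathcal A$ is an $LA2$-type equation if: (i) $D$ is a non-square positive integer; (ii) $D\mid E$; (iii) $2a\mid b$, $a\mid c$ and $2a\mid d$; (iv) $4a^2D\mid N$. $\mathcal{Z}$ is the set of all $LA2$-type equations, and for $j\in\mathbb{Z}$, $\mathcal{Z}(j)=\left\{A\in\mathcal{Z}: j=\frac{N}{-4a^2D}\right\}$. For $A\in\mathcal Z$, $\lambda$ is an integer and $\tau$ is a non-square positive integer. *)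

(* Defs.v *)
From HB Require Import structures.
From mathcomp Require Import all_boot all_order all_algebra.
From mathcomp Require Import boolp classical_sets functions cardinality.
From mathcomp Require Import ring lra zify.

Set Implicit Arguments.
Unset Strict Implicit.
Unset Printing Implicit Defensive.

Import Order.TTheory GRing.Theory Num.Theory.

Local Open Scope classical_set_scope.
Local Open Scope ring_scope.

(* The equation a u^2 + b u v + c v^2 + d u + e v + f = 0, represented by its
   coefficients. *)
Record quad_eq := QuadEq {
  qa : int; qb : int; qc : int; qd : int; qe : int; qf : int }.

Definition satisfies (A : quad_eq) (u v : int) : Prop :=
  qa A * u ^+ 2 + qb A * u * v + qc A * v ^+ 2 + qd A * u + qe A * v + qf A = 0.

Definition calA : set quad_eq :=
  [set A | 0 < qa A /\
    gcdz (qa A) (gcdz (qb A) (gcdz (qc A)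
      (gcdz (qd A) (gcdz (qe A) (qf A))))) = 1].

Definition qD (A : quad_eq) : int := qb A ^+ 2 - 4 * qa A * qc A.
Definition qE (A : quad_eq) : int := qb A * qd A - 2 * qa A * qe A.
Definition qF (A : quad_eq) : int := qd A ^+ 2 - 4 * qa A * qf A.
Definition qN (A : quad_eq) : int := qE A ^+ 2 - qD A * qF A.

Definition nonsquare (n : int) : Prop := ~ exists k : int, n = k ^+ 2.

Definition LA2 (A : quad_eq) : Prop :=
  [/\ 0 < qD A /\ nonsquare (qD A),
      (qD A %| qE A)%Z,
      [/\ (2 * qa A %| qb A)%Z, (qa A %| qc A)%Z & (2 * qa A %| qd A)%Z] &
      (4 * qa A ^+ 2 * qD A %| qN A)%Z].

Definition calZ : set quad_eq := [set A | calA A /\ LA2 A].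

Definition calZj (j : int) : set quad_eq :=
  [set A | calZ A /\ j%:Q = (qN A)%:Q / (- (4 * qa A ^+ 2 * qD A))%:Q].

(* On calZ the four integer quotients below are exact: see lambdaE, tauE,
   half_dE and quoEDE. *)
Definition lambda (A : quad_eq) : int := (qb A %/ 2)%Z.
Definition tau (A : quad_eq) : int := (qD A %/ 4)%Z.
Definition half_d (A : quad_eq) : int := (qd A %/ 2)%Z.
Definition quoED (A : quad_eq) : int := (qE A %/ qD A)%Z.

Definition sol (A : quad_eq) : set (int * int) :=
  [set p | satisfies A p.1 p.2].

Definition pell (t : int) : set (int * int) :=
  [set p | p.1 ^+ 2 - t * p.2 ^+ 2 = 1].

Lemma exact_quo (m n : int) : n != 0 -> (n %| m)%Z ->
  (m %/ n)%Z%:Q = m%:Q / n%:Q.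
Proof.
move=> n0 nm; apply: (mulIf (x := n%:Q)); first by rewrite intr_eq0.
by rewrite -intrM divzK // mulfVK ?intr_eq0.
Qed.

Lemma dvd2_qb A : calZ A -> (2 %| qb A)%Z.
Proof. by move=> [_ [_ _ [h _ _] _]]; apply: dvdz_trans h; apply: dvdz_mulr. Qed.

Lemma dvd2_qd A : calZ A -> (2 %| qd A)%Z.
Proof. by move=> [_ [_ _ [_ _ h] _]]; apply: dvdz_trans h; apply: dvdz_mulr. Qed.

Lemma dvd4_qD A : calZ A -> (4 %| qD A)%Z.
Proof.
move=> /dvd2_qb /dvdzP[k bE]; apply/dvdzP; exists (k ^+ 2 - qa A * qc A).
by rewrite /qD bE; ring.
Qed.

Lemma lambdaE A : calZ A -> (lambda A)%:Q = (qb A)%:Q / 2.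
Proof. by move=> /dvd2_qb h; rewrite exact_quo. Qed.

Lemma tauE A : calZ A -> (tau A)%:Q = (qD A)%:Q / 4.
Proof. by move=> /dvd4_qD h; rewrite exact_quo. Qed.

Lemma half_dE A : calZ A -> (half_d A)%:Q = (qd A)%:Q / 2.
Proof. by move=> /dvd2_qd h; rewrite exact_quo. Qed.

Lemma quoEDE A : calZ A -> (quoED A)%:Q = (qE A)%:Q / (qD A)%:Q.
Proof.
by move=> [_ [[D0 _] h _ _]]; rewrite exact_quo //; apply: lt0r_neq0.
Qed.

Lemma tau_gt0_nonsquare A : calZ A -> 0 < tau A /\ nonsquare (tau A).
Proof.
move=> ZA; have := divzK (dvd4_qD ZA); rewrite -/(tau A) => DE.
case: ZA => _ [[D0 nsq] _ _ _]; split; first by lia.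
by move=> [k tE]; apply: nsq; exists (2 * k); rewrite -DE tE; ring.
Qed.

(* Main.v *)
(* The divisibility hypotheses force a to divide every coefficient, so a = 1, and
   completing squares turns the equation into x^2 - tau y^2 = j.

   For j = 1 the solutions correspond to those of the Pell equation, whose
   nontrivial solution comes from reduction of indefinite forms: starting from
   x^2 - tau y^2 and the standard basis of Z^2, repeatedly replace one basis
   vector by the sum of the two, so that the first keeps positive and the second
   negative norm.  The Gram matrices all have determinant - tau and entries of
   opposite sign on the diagonal, so there are finitely many of them and two
   bases have the same one.  The change of basis is an automorph of the form,
   which is nontrivial because the entries of the bases grow. *)
Require Import Defs.
From mathcomp Require Import all_boot all_order all_algebra.
From mathcomp Require Import boolp classical_sets functions cardinality.
From mathcomp Require Import ring zify.

Set Implicit Arguments.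
Unset Strict Implicit.
Unset Printing Implicit Defensive.

Import Order.TTheory GRing.Theory Num.Theory.

Local Open Scope classical_set_scope.
Local Open Scope ring_scope.

(** * Integer preliminaries *)

Lemma eq_of_sqr_eq (x y : int) : 0 <= x -> 0 <= y -> x ^+ 2 = y ^+ 2 -> x = y.
Proof. by move=> x0 y0 /eqP; rewrite eqrXn2 // => /eqP. Qed.

Lemma eq1_of_mul_eq1 (x y : int) : 0 <= x -> x * y = 1 -> x = 1.
Proof.
move=> x0 xy; have x_neq0 : x != 0 by apply/eqP => x_0; rewrite x_0 mul0r in xy.
by have [y0|y0] := lerP y 0; nia.
Qed.

(** * A nontrivial Pell solution by reduction of bases *)

Section PellExistence.
Variables (t : int) (t_gt0 : 0 < t) (t_nsq : nonsquare t).

(* An ordered basis (p, q), (r, s) of Z^2. *)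
Record basis := Basis { bp : int; bq : int; br : int; bs : int }.

Definition gramA (m : basis) : int := bp m ^+ 2 - t * bq m ^+ 2.
Definition gramB (m : basis) : int := bp m * br m - t * bq m * bs m.
Definition gramC (m : basis) : int := br m ^+ 2 - t * bs m ^+ 2.

(** A measure that grows at every step and so tells apart bases with the same Gram matrix. *)
Definition size_basis (m : basis) : int := bp m + bq m + br m + bs m.

(** The tested quantity is the norm of the sum of the two basis vectors; its sign decides which
    vector the sum replaces. *)
Definition basis_step (m : basis) : basis :=
  let: Basis p q r s := m in
  if 0 < gramA m + 2 * gramB m + gramC m then Basis (p + r) (q + s) r s
  else Basis p q (p + r) (q + s).

Definition basis_seq (n : nat) : basis := iter n basis_step (Basis 1 0 0 1).

Definition admissible (m : basis) : Prop :=
  [/\ [/\ 0 < bp m, 0 <= bq m, 0 <= br m & 0 < bs m],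
      bp m * bs m - bq m * br m = 1, 0 < gramA m & gramC m < 0].

(** A zero norm would give [y ^+ 2] dividing [x ^+ 2], hence [y] dividing [x], and [t] would be the
    square of the quotient. *)
Lemma norm_neq0 (x y : int) : y != 0 -> x ^+ 2 - t * y ^+ 2 != 0.
Proof.
move=> y0; apply/negP => /eqP h.
have xE : x ^+ 2 = t * y ^+ 2 by lia.
have /dvdzP[k xk] : (y %| x)%Z.
  by rewrite dvdzE -(@dvdn_pexp2r _ _ 2) // -!abszX xE -dvdzE dvdz_mull.
apply: t_nsq; exists k.
apply: (mulIf (x := y ^+ 2)); first by rewrite expf_neq0.
by rewrite -xE xk; ring.
Qed.

Lemma admissible_step m :
  admissible m -> admissible (basis_step m) /\ size_basis m < size_basis (basis_step m).
Proof.
case: m => p q r s [] /= [] p0 q0 r0 s0 det; rewrite /gramA /gramC /= => hA hC.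
have := @norm_neq0 (p + r) (q + s) ltac:(lia).
rewrite /gramA /gramB /gramC /=.
have -> : p ^+ 2 - t * q ^+ 2 + 2 * (p * r - t * q * s) + (r ^+ 2 - t * s ^+ 2) =
  (p + r) ^+ 2 - t * (q + s) ^+ 2 by ring.
move=> n0; case: ltP => h; rewrite /size_basis /admissible /gramA /gramC /=.
- by split; [split => //; [split; lia | lia] | lia].
- split; last by lia.
  by split => //; [split; lia | lia | rewrite lt_neqAle n0].
Qed.

Lemma admissible_seq n : admissible (basis_seq n).
Proof.
elim: n => [|n IH]; last by case: (admissible_step IH).
by split => //; rewrite /gramA /gramC /=; lia.
Qed.

Lemma size_basis_seq m n :
  (m < n)%N -> size_basis (basis_seq m) < size_basis (basis_seq n).
Proof.
have S k : size_basis (basis_seq k) < size_basis (basis_seq k.+1).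
  by case: (admissible_step (admissible_seq k)).
elim: n => // n IH; rewrite ltnS leq_eqVlt => /orP[/eqP ->|/IH h]; first exact: S.
exact: lt_trans h (S n).
Qed.

(** Determinant 1 gives [gramB ^+ 2 - gramA * gramC = t], where both [gramB ^+ 2] and
    [- gramA * gramC] are nonnegative. *)
Lemma gram_bound m : admissible m ->
  [/\ 0 < gramA m <= t, - t <= gramB m <= t & - t <= gramC m < 0].
Proof.
case=> _ det hA hC.
have disc : gramB m ^+ 2 - gramA m * gramC m = t.
  rewrite -[RHS]mulr1 -[in RHS](expr1n int 2) -det /gramA /gramB /gramC; ring.
move: disc hA hC; set a := gramA m; set b := gramB m; set c := gramC m => disc hA hC.
have hb : `|b| <= b ^+ 2 by have [b0|b0] := lerP 0 b; nia.
have : a <= a * - c by nia.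
have : - c <= a * - c by nia.
by split; lia.
Qed.

(** A finite code for the pigeonhole argument. The shift by [t] makes [gramB] nonnegative; the
    absolute value of [gramC] loses nothing, since its sign is fixed on admissible bases. *)
Definition gram_code (m : basis) : 'I_(`|t|.+1) * 'I_(`|(2 * t)%R|.+1) * 'I_(`|t|.+1) :=
  (inord `|gramA m|, inord `|gramB m + t|, inord `|gramC m|).

Lemma gram_code_inj m n : admissible m -> admissible n ->
  gram_code m = gram_code n ->
  [/\ gramA m = gramA n, gramB m = gramB n & gramC m = gramC n].
Proof.
move=> /gram_bound[a1 b1 c1] /gram_bound[a2 b2 c2] [].
move=> /(congr1 val) /= ha /(congr1 val) /= hb /(congr1 val) /= hc.
by move: ha hb hc; rewrite !inordK; try lia; move=> ha hb hc; split; lia.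
Qed.

Lemma gram_collision : exists i k : nat, (i < k)%N /\
  gram_code (basis_seq i) = gram_code (basis_seq k).
Proof.
pose f (i : 'I_(#|{: 'I_(`|t|.+1) * 'I_(`|(2 * t)%R|.+1) * 'I_(`|t|.+1)}|.+1)) :=
  gram_code (basis_seq i).
have /injectivePn[i [k ik fik]] : ~~ injectiveb f.
  by apply/negP => /injectiveP /leq_card; rewrite card_ord ltnn.
have [lt|lt|e] := ltngtP i k.
- by exists i, k.
- by exists k, i.
- by case/eqP: ik; apply: val_inj.
Qed.

Lemma pell_nontrivial : exists x y : int, x ^+ 2 - t * y ^+ 2 = 1 /\ y != 0.
Proof.
have [i [k [ltik]]] := gram_collision.
have := size_basis_seq ltik.
have := admissible_seq i; have := admissible_seq k.
move: (basis_seq i) (basis_seq k) => m n adn adm szlt code.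
have [eA eB eC] := gram_code_inj adm adn code.
case: m n adm adn szlt eA eB eC {code} => p q r s [p' q' r' s'].
rewrite /admissible /size_basis /gramA /gramB /gramC /=.
move=> [[p0 q0 r0 s0] det _ _] [[p0' q0' r0' s0'] det' _ _] szlt eA eB eC.
(* The first column of M' M^-1, where M and M' have the bases as columns. *)
exists (p' * s - r' * q), (q' * s - s' * q); split.
  (* The witness is [s (p', q') - q (r', s')]. As the Gram matrices agree, its norm is that of
     [s (p, q) - q (r, s)], which is [(1, 0)]. *)
  transitivity (s ^+ 2 * (p' ^+ 2 - t * q' ^+ 2)
    - 2 * s * q * (p' * r' - t * q' * s') + q ^+ 2 * (r' ^+ 2 - t * s' ^+ 2)).
    by ring.
  by rewrite -eA -eB -eC -[RHS](expr1n int 2) -[in RHS]det; ring.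
(* If the second entry vanishes, [(q', s')] is [c] times [(q, s)]; the determinant forces [c = 1],
   equal norms then make the bases equal, against the growth of the size. *)
apply/negP => /eqP y0.
pose c := p * s' - r * q'.
have q'E : q' = q * c.
  rewrite -[LHS]mulr1 -det.
  have -> : q' * (p * s - q * r) = p * (q' * s - s' * q) + q * c by rewrite /c; ring.
  by rewrite y0 mulr0 add0r.
have s'E : s' = s * c.
  rewrite -[LHS]mulr1 -det.
  have -> : s' * (p * s - q * r) = r * (q' * s - s' * q) + s * c by rewrite /c; ring.
  by rewrite y0 mulr0 add0r.
have c1 : c = 1.
  apply: (@eq1_of_mul_eq1 _ (p' * s - r' * q)); first by nia.
  by rewrite -det' [in RHS]s'E [in RHS]q'E; ring.
move: q'E s'E; rewrite c1 !mulr1 => q'E s'E; subst q' s'.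
have pE : p = p' by apply: eq_of_sqr_eq; lia.
have rE : r = r' by apply: eq_of_sqr_eq; lia.
by subst; rewrite ltxx in szlt.
Qed.

(** * Infinitely many Pell solutions *)

(** The square of [x + y sqrt t]. *)
Definition pell_double (z : int * int) : int * int :=
  (z.1 ^+ 2 + t * z.2 ^+ 2, 2 * z.1 * z.2).

Lemma pell_double_sol z : pell t z -> pell t (pell_double z).
Proof.
rewrite /pell /pell_double /= => h.
by rewrite -[RHS](expr1n int 2) -[in RHS]h; ring.
Qed.

Lemma pell_double_lt z : pell t z -> z.2 != 0 -> `|z.2| < `|(pell_double z).2|.
Proof.
case: z => x y; rewrite /pell /pell_double /= => h y0.
have x0 : x != 0 by apply/eqP => x0; move: h; rewrite x0; nia.
rewrite !normrM.
have : 1 <= `|x| by lia.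
have : 1 <= `|y| by lia.
have -> : `|2 : int| = 2 by [].
nia.
Qed.

Lemma pell_injective_seq : exists g : nat -> int * int,
  injective g /\ forall n, pell t (g n).
Proof.
have [x [y [xy y0]]] := pell_nontrivial.
pose g n := iter n pell_double (x, y).
have gP n : pell t (g n) /\ (g n).2 != 0.
  elim: n => [//|n [h1 h2]]; split; first exact: pell_double_sol.
  by rewrite -normr_gt0; apply: le_lt_trans (pell_double_lt h1 h2).
have gmono : {homo g : m n / (m < n)%N >-> `|m.2| < `|n.2|}.
  apply: (homo_ltn (r := fun a b : int * int => `|a.2| < `|b.2|)).
    by move=> b a c; apply: lt_trans.
  by move=> n; have [h1 h2] := gP n; apply: pell_double_lt.
exists g; split; last by move=> n; case: (gP n).
move=> m n e; have [/gmono|/gmono|//] := ltngtP m n; by rewrite e ltxx.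
Qed.

End PellExistence.

(** * Normal form of the equations in [calZ] *)

Lemma qa_eq1 A : calZ A -> qa A = 1.
Proof.
case: A => a b c d e f [[/= a0 gcd1]] [[D0 _] /dvdzP[k kE]].
move=> [/dvdzP[b' bE] /dvdzP[c' cE] /dvdzP[d' dE]] /dvdzP[l lE].
move: D0 kE lE gcd1 bE cE dE; rewrite /qN /qE /qF /qD /=.
move=> D0 kE lE gcd1 bE cE dE.
have a_neq0 : a != 0 by lia.
(* Solve [E = k D] for [e], and below [N = 4 l a^2 D] for [f]: both are multiples of [a]. *)
have eE : e = a * (2 * b' * d' - 2 * k * (b' ^+ 2 - c')).
  apply: (mulfI (x := 2 * a)); first by lia.
  have -> : 2 * a * e = b * d - (b * d - 2 * a * e) by ring.
  by rewrite kE bE cE dE; ring.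
have fE : f = a * (d' ^+ 2 + l - k ^+ 2 * (b' ^+ 2 - c')).
  apply: (mulfI (x := 4 * a * (b ^+ 2 - 4 * a * c))).
    by rewrite mulf_neq0 //; lia.
  have -> : 4 * a * (b ^+ 2 - 4 * a * c) * f =
    (b * d - 2 * a * e) ^+ 2 - (b ^+ 2 - 4 * a * c) * (d ^+ 2 - 4 * a * f)
    - (b * d - 2 * a * e) ^+ 2 + (b ^+ 2 - 4 * a * c) * d ^+ 2 by ring.
  by rewrite lE kE bE cE dE; ring.
have : (a %| 1%R)%Z.
  rewrite -gcd1 !dvdz_gcd dvdzz eE fE !dvdz_mulr //= bE cE dE.
  by rewrite !dvdz_mull ?dvdz_mull.
by rewrite dvdz1; lia.
Qed.

Lemma satisfiesE j A (u v : int) : calZj j A ->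
  satisfies A u v <->
  (u + lambda A * v + half_d A) ^+ 2 - tau A * (v + quoED A) ^+ 2 = j.
Proof.
move=> [ZA jE]; have a1 := qa_eq1 ZA.
have lamE : qb A = lambda A * 2 by rewrite divzK // dvd2_qb.
have hdE : qd A = half_d A * 2 by rewrite divzK // dvd2_qd.
have tE : qD A = tau A * 4 by rewrite divzK // dvd4_qD.
have [t0 _] := tau_gt0_nonsquare ZA.
have kE : qE A = quoED A * qD A by rewrite divzK //; case: ZA => _ [].
have NE : qN A = - (4 * qD A) * j.
  apply/eqP; rewrite -(eqr_int rat) intrM jE a1 expr1n mulr1 mulrC divfK //.
  by rewrite intr_eq0; lia.
set X := _ - _; set Q := qa A * u ^+ 2 + qb A * u * v + qc A * v ^+ 2 + qd A * u
  + qe A * v + qf A.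
suff QE : Q = X - j by rewrite /satisfies -/Q QE; split; lia.
apply: (mulfI (x := 4 * qD A)); first by lia.
(* Completing the square in [u], then in [v], with [a = 1]. *)
have -> : 4 * qD A * Q =
  qD A * (2 * u + qb A * v + qd A) ^+ 2 - (qD A * v + qE A) ^+ 2 + qN A.
  by rewrite /Q /qN /qE /qF /qD a1; ring.
by rewrite NE kE lamE hdE tE /X; ring.
Qed.

Theorem theorem1p3 (j : int) (A : quad_eq) (hA : calZj j A) :
  [/\ qa A = 1,
      (forall u v : int,
         satisfies A u v <->
         (u + lambda A * v + half_d A) ^+ 2 - tau A * (v + quoED A) ^+ 2 = j) &
      (j = 1 ->
         [/\ sol A !=set0,
             infinite_set (sol A) &
             sol A =
             [set (q.1 - lambda A * q.2 + quoED A * lambda A - half_d A,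
                   q.2 - quoED A) | q in pell (tau A)]])].
Proof.
split; [exact: qa_eq1 hA.1 | by move=> u v; exact: satisfiesE | move=> j1].
pose phi (q : int * int) :=
  (q.1 - lambda A * q.2 + quoED A * lambda A - half_d A, q.2 - quoED A).
rewrite -/phi.
have solE : sol A = phi @` pell (tau A).
  apply/seteqP; split=> [[u v] /= /(satisfiesE u v hA)|_ [[x y] xy <-]].
    rewrite j1 => h; exists (u + lambda A * v + half_d A, v + quoED A) => //.
    by congr pair => /=; ring.
  apply/(satisfiesE _ _ hA); rewrite j1 -[RHS]xy /=; ring.
have [t0 tnsq] := tau_gt0_nonsquare hA.1.
have [g [ginj gP]] := pell_injective_seq t0 tnsq.
have phi_inj : injective phi.
  move=> [x y] [x' y']; case=> h1 /addIr yE.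
  by subst y'; congr pair; move: h1; lia.
have solg n : sol A (phi (g n)) by rewrite solE; exists (g n).
split=> //; first by exists (phi (g 0%N)).
(* A finite solution set would pull back along the injective [phi \o g] to make [nat] finite. *)
move=> fin; apply: infinite_nat.
rewrite (_ : setT = (phi \o g) @^-1` sol A); last first.
  by apply/seteqP; split=> // n _; apply: solg.
by apply: finite_preimage fin => m n _ _ /phi_inj /ginj.
Qed.
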